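(* Let $F_1$ be an infinitesimal deformation (a 2-cocycle of the differential Hochschild complex) of $C^\infty(\mathbb{R}^3)$ whose primary obstruction $F_1\circ F_1$ is a coboundary. Then for every $\varphi\in C^\infty(\mathbb{R}^3)$ the primary obstruction of $\varphi F_1$ is also a coboundary. In particular, if a skew biderivation $F_1$ of $C^\infty(\mathbb{R}^3)$ is a Poisson bracket, then so is $\varphi F_1$ for every $\varphi\in C^\infty(\mathbb{R}^3)$.
   Context: The differential Hochschild complex of $C^\infty(\mathbb{R}^3)$ consists of Hochschild cochains that are multidifferential operators with smooth coefficients. For 2-cochains, $(F\circ G)(a,b,c)=F(G(a,b),c)-F(a,G(b,c))$; the primary obstruction of a 2-cocycle $F_1$ is $F_1\circ F_1$. A Poisson bracket is a skew biderivation satisfying the Jacobi identity. $(\varphi F)(a,b)=\varphi\,F(a,b)$. *)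

(* Defs.v *)
From HB Require Import structures.
From mathcomp Require Import all_boot all_order all_algebra.
From mathcomp Require Import all_classical all_reals all_analysis.
Set Implicit Arguments. Unset Strict Implicit. Unset Printing Implicit Defensive.
Import Order.TTheory GRing.Theory Num.Theory.
Import numFieldNormedType.Exports.
Local Open Scope ring_scope.

Section Defs.
Variable R : realType.

Definition pt := 'rV[R]_3.
(* functions R^3 -> R (C^oo(R^3) is the subset of smooth ones) *)
Definition fn := pt -> R.

Definition ebasis (i : 'I_3) : pt := delta_mx 0 i.

Definition partial (i : 'I_3) (f : fn) : fn := fun x => derive f x (ebasis i).

Definition dpow (s : seq 'I_3) (f : fn) : fn := foldr partial f s.

Definition smooth (f : fn) : Prop :=
  forall (s : seq 'I_3) (x : pt), differentiable (dpow s f) x.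

(* a 2-cochain in the differential Hochschild complex: a bidifferential
   operator with smooth coefficients (on smooth arguments) *)
Definition diff2 (F : fn -> fn -> fn) : Prop :=
  exists (N : nat) (c : 'I_N -> fn) (s1 s2 : 'I_N -> seq 'I_3),
    (forall k, smooth (c k)) /\
    forall f g, smooth f -> smooth g ->
      F f g = fun x => \sum_(k < N) c k x * dpow (s1 k) f x * dpow (s2 k) g x.

Definition hoch2 (F : fn -> fn -> fn) (a b c : fn) : fn :=
  fun x => a x * F b c x - F (a \* b) c x + F a (b \* c) x - F a b x * c x.

Definition cocycle2 (F : fn -> fn -> fn) : Prop :=
  forall a b c, smooth a -> smooth b -> smooth c -> hoch2 F a b c = (fun _ => 0).

Definition circ (F G : fn -> fn -> fn) (a b c : fn) : fn :=
  fun x => F (G a b) c x - F a (G b c) x.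

Definition coboundary3 (T : fn -> fn -> fn -> fn) : Prop :=
  exists H, diff2 H /\
    forall a b c, smooth a -> smooth b -> smooth c -> T a b c = hoch2 H a b c.

Definition scal (phi : fn) (F : fn -> fn -> fn) : fn -> fn -> fn :=
  fun a b x => phi x * F a b x.

Definition skew_biderivation (F : fn -> fn -> fn) : Prop :=
  [/\ (forall a b, smooth a -> smooth b -> smooth (F a b)),
      (forall a b, smooth a -> smooth b -> F a b = (fun x => - F b a x)),
      (forall (l : R) a b c, smooth a -> smooth b -> smooth c ->
          F (fun x => l * a x + b x) c = (fun x => l * F a c x + F b c x)) &
      (forall a b c, smooth a -> smooth b -> smooth c ->
          F (a \* b) c = (fun x => a x * F b c x + F a c x * b x))].

Definition poisson (F : fn -> fn -> fn) : Prop :=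
  skew_biderivation F /\
  forall a b c, smooth a -> smooth b -> smooth c ->
    (fun x => F a (F b c) x + F b (F c a) x + F c (F a b) x) = (fun _ => 0).

End Defs.

(* Main.v *)
(** For a 2-cocycle [F], put [Q(a,b) = F(a,b) - F(b,a)], [L(u) = F(phi,u)] and
[D(u) = Q(u,phi)]. The cocycle identities give
[phi F o phi F = phi^2 (F o F) + phi (delta(L o F) - D \cup F)], so it suffices
that [D \cup F] is a coboundary. The symmetric part of [F] is [delta G] for a
differential operator [G], and [D \cup delta G = - delta(D \cup G)]. The
skew part [Q] is a bivector field; in dimension 3 it satisfies the Pluecker
relation [D(a)Q(b,c) + D(b)Q(c,a) + D(c)Q(a,b) = 0], which makes the
antisymmetrisation of the triderivation [D \cup Q] vanish, hence [D \cup Q] is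
a coboundary. The same relation yields the Jacobi identity for [phi F].

That biderivations are bivector fields, and that partial derivatives commute,
both follow from Hadamard's lemma. The symmetric part is treated through its
symbol, obtained by evaluating on exponentials. *)

Require Import Defs.
From HB Require Import structures.
From mathcomp Require Import all_boot all_order all_algebra.
From mathcomp Require Import all_classical all_reals all_analysis.
From mathcomp Require Import ring lra.
Set Implicit Arguments. Unset Strict Implicit. Unset Printing Implicit Defensive.
Import Order.TTheory GRing.Theory Num.Theory.
Import numFieldNormedType.Exports.
Local Open Scope classical_set_scope.
Local Open Scope ring_scope.

(** * Smooth functions *)

Section Smooth.
Context {R : realType}.
Implicit Types (f g : fn R) (x y z h : pt R) (i j k : 'I_3) (s : seq 'I_3).

Lemma smooth_differentiable f x : smooth f -> differentiable f x.
Proof. exact: (fun sf => sf [::] x). Qed.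

Lemma smooth_partial i f : smooth f -> smooth (partial i f).
Proof. by move=> sf s x; have := sf (rcons s i) x; rewrite /dpow foldr_rcons. Qed.

Lemma smooth_dpow s f : smooth f -> smooth (dpow s f).
Proof. by move=> sf; elim: s => //= i s ih; exact: smooth_partial. Qed.

(** Every iterated partial derivative of a member of a stable class is again a member. Smoothness
    can thus be shown by exhibiting a stable class, without formulas for iterated derivatives. *)
Lemma smooth_coind (P : fn R -> Prop) :
  (forall f, P f -> forall x, differentiable f x) ->
  (forall f i, P f -> P (partial i f)) ->
  forall f, P f -> smooth f.
Proof.
move=> Pd Pp f Pf s; apply: Pd.
by elim: s => //= i s; exact: Pp.
Qed.

Lemma partial_cst i (c : R) : partial i (fun _ => c) = (fun _ => 0).
Proof. by apply/funext => x; rewrite /partial derive_cst. Qed.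

Lemma partial_add i f g : (forall x, differentiable f x) ->
  (forall x, differentiable g x) ->
  partial i (fun x => f x + g x) = (fun x => partial i f x + partial i g x).
Proof.
move=> df dg; apply/funext => x.
by rewrite /partial (@deriveD _ _ _ f g)//; exact: diff_derivable.
Qed.

Lemma partial_mul i f g : (forall x, differentiable f x) ->
  (forall x, differentiable g x) ->
  partial i (fun x => f x * g x) =
  (fun x => f x * partial i g x + partial i f x * g x).
Proof.
move=> df dg; apply/funext => x.
rewrite /partial (@deriveM _ _ f g); try exact: diff_derivable.
by rewrite -![_ *: _]/(_ * _) [g x * _]mulrC.
Qed.

Lemma partial_coord i j :
  partial i (fun x => x 0 j) = (fun _ => (i == j)%:R).
Proof.
apply/funext => x; rewrite /partial /derive; apply: cvg_lim => //.
apply: cvg_near_cst.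
have : \forall t \near dnbhs (0 : R), t != 0 by exact: nbhs_dnbhs_neq.
apply: filterS => t t0 /=.
by rewrite !mxE addrK eqxx /= eq_sym -[_ *: _]/(_ * _) mulKf.
Qed.

(** Products of smooth functions alone are not stable under [partial], since Leibniz produces sums
    of products. Closing under both operations gives a class to which [smooth_coind] applies. *)
Inductive smooth_gen : fn R -> Prop :=
| SGbase f of smooth f : smooth_gen f
| SGcst c : smooth_gen (fun _ => c)
| SGcoord i : smooth_gen (fun x => x 0 i)
| SGadd f g of smooth_gen f & smooth_gen g : smooth_gen (fun x => f x + g x)
| SGmul f g of smooth_gen f & smooth_gen g : smooth_gen (fun x => f x * g x).

Lemma smooth_gen_smooth f : smooth_gen f -> smooth f.
Proof.
have dgen : forall f, smooth_gen f -> forall x, differentiable f x.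
  move=> {}f; elim=> {f}.
  - by move=> f sf x; exact: smooth_differentiable.
  - by move=> c x; exact: differentiable_cst.
  - by move=> i x; exact: differentiable_coord.
  - by move=> f g _ df _ dg x; exact: (@differentiableD _ _ _ f g).
  - by move=> f g _ df _ dg x; exact: (@differentiableM _ _ f g).
apply: smooth_coind => // {}f i; elim=> {f}.
- by move=> f sf; apply/SGbase/smooth_partial.
- by move=> c; rewrite partial_cst; exact: SGcst.
- by move=> j; rewrite partial_coord; exact: SGcst.
- move=> f g gf pf gg pg; rewrite partial_add; try exact: dgen.
  exact: SGadd.
- move=> f g gf pf gg pg; rewrite partial_mul; try exact: dgen.
  by apply: SGadd; exact: SGmul.
Qed.

Lemma smooth_cst (c : R) : smooth (fun _ : pt R => c).
Proof. exact/smooth_gen_smooth/SGcst. Qed.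

Lemma smooth_coord i : smooth (fun x : pt R => x 0 i).
Proof. exact/smooth_gen_smooth/SGcoord. Qed.

Lemma smooth_add f g : smooth f -> smooth g -> smooth (fun x => f x + g x).
Proof. by move=> *; apply/smooth_gen_smooth/SGadd; exact: SGbase. Qed.

Lemma smooth_mul f g : smooth f -> smooth g -> smooth (fun x => f x * g x).
Proof. by move=> *; apply/smooth_gen_smooth/SGmul; exact: SGbase. Qed.

Lemma smooth_opp f : smooth f -> smooth (fun x => - f x).
Proof.
move=> sf; rewrite (_ : (fun _ => _) = fun x => -1 * f x); last first.
  by apply/funext => x; rewrite mulN1r.
by apply: smooth_mul => //; exact: smooth_cst.
Qed.

Lemma smooth_sub f g : smooth f -> smooth g -> smooth (fun x => f x - g x).
Proof. by move=> sf sg; apply: smooth_add => //; exact: smooth_opp. Qed.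

Lemma smooth_sum (I : Type) (r : seq I) (F : I -> fn R) :
  (forall a, smooth (F a)) -> smooth (fun x => \sum_(a <- r) F a x).
Proof.
move=> sF; elim: r => [|a r ih].
  by under eq_fun do rewrite big_nil; exact: smooth_cst.
by under eq_fun do rewrite big_cons; exact: smooth_add.
Qed.

Lemma partialD i f g : smooth f -> smooth g ->
  partial i (fun x => f x + g x) = (fun x => partial i f x + partial i g x).
Proof. by move=> sf sg; apply: partial_add => x; exact: smooth_differentiable. Qed.

Lemma partialM i f g : smooth f -> smooth g ->
  partial i (f \* g) = (fun x => f x * partial i g x + partial i f x * g x).
Proof. by move=> sf sg; apply: partial_mul => x; exact: smooth_differentiable. Qed.

Lemma partial_sum (I : Type) (r : seq I) (F : I -> fn R) i :
  (forall a, smooth (F a)) ->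
  partial i (fun x => \sum_(a <- r) F a x) =
  (fun x => \sum_(a <- r) partial i (F a) x).
Proof.
move=> sF; elim: r => [|a r ih].
  under eq_fun do rewrite big_nil.
  by rewrite partial_cst; apply/funext => x; rewrite big_nil.
under eq_fun do rewrite big_cons.
rewrite partialD//; last exact: smooth_sum.
by rewrite ih; apply/funext => x; rewrite big_cons.
Qed.

(** * Expansion along segments *)

Lemma diff_partial f x h : differentiable f x ->
  'd f x h = \sum_i h 0 i * partial i f x.
Proof.
move=> df; rewrite {1}[h]row_sum_delta linear_sum; apply: eq_bigr => i _.
by rewrite linearZ /partial deriveE.
Qed.

Lemma is_derive_line f z h (t : R) : smooth f ->
  is_derive t 1 (fun t : R => f (z + t *: h))
    (\sum_i h 0 i * partial i f (z + t *: h)).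
Proof.
move=> sf; have df := smooth_differentiable (z + t *: h) sf.
have dl : is_diff t (fun t : R => z + t *: h) (fun t => t *: h).
  have -> : (fun t : R => z + t *: h) = cst z + ( *:%R^~ h) by [].
  have dD := is_diffD (is_diff_cst z t) (is_diff_scalel t h).
  by apply: DiffDef; [exact: ex_diff|rewrite diff_val add0r].
have dfl : is_diff t (f \o (fun t : R => z + t *: h))
    ('d f (z + t *: h) \o (fun t => t *: h)).
  by apply: is_diff_comp; exact: differentiableP.
apply: DeriveDef; first by apply: diff_derivable; exact: (@ex_diff _ _ _ _ _ _ _ dfl).
rewrite deriveE; last exact: (@ex_diff _ _ _ _ _ _ _ dfl).
by rewrite (@diff_val _ _ _ _ _ _ _ dfl) /= scale1r diff_partial.
Qed.

Lemma norm_coord_le x i : `|x 0 i| <= `|x|.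
Proof.
rewrite [leRHS]mx_normrE.
by apply: (le_trans _ (le_bigmax _ _ (0, i))).
Qed.

(** Closed balls of R^3 are compact, so the extreme value theorem applies to [|f|]. *)
Lemma smooth_bounded f (r : R) : 0 <= r -> smooth f ->
  exists M : R, forall x, `|x| <= r -> `|f x| <= M.
Proof.
move=> r0 sf; pose B := closed_ball_ (@Num.norm R 'rV[R]_3) (0 : 'rV[R]_3) r.
have Bx x : x \in B = (`|x| <= r).
  by apply/idP/idP; rewrite inE /B /closed_ball_/= sub0r normrN.
have cB : compact B.
  apply: bounded_closed_compact; last exact: closed_closed_ball_.
  exists r; split; first exact: num_real.
  by move=> M rM x /mem_set; rewrite Bx => xr; exact: (le_trans xr (ltW rM)).
have cf : {within B, continuous (fun x => `|f x|)}.
  apply: continuous_subspaceT => x.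
  apply: continuous_comp; last exact: norm_continuous.
  exact: differentiable_continuous (smooth_differentiable x sf).
have [|c _ cmax] := EVT_max_rV _ cB cf.
  by exists 0; apply: set_mem; rewrite Bx normr0.
by exists `|f c| => x xr; apply: cmax; rewrite Bx.
Qed.

(** Two applications of the mean value theorem along the segment from [z] to [z + h] express the
    remainder by second derivatives, which are bounded on the ball of radius [r]. That [M] is
    uniform in [z] is what later permits differentiation under the integral. *)
Lemma taylor_quadratic f (r : R) : 0 <= r -> smooth f ->
  exists2 M : R, 0 <= M & forall z h, `|z| + `|h| <= r ->
    `|f (z + h) - f z - \sum_i h 0 i * partial i f z| <= M * `|h| ^+ 2.
Proof.
move=> r0 sf.
have /fin_all_exists[M MP] (p : 'I_3 * 'I_3) : exists M : R, forall x, `|x| <= r ->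
    `|partial p.1 (partial p.2 f) x| <= M.
  by apply: smooth_bounded => //; do 2 apply: smooth_partial.
have M0 p : 0 <= M p.
  by apply: le_trans (normr_ge0 _) (MP p 0 _); rewrite normr0.
exists (\sum_j \sum_i M (i, j)); first by do 2 apply: sumr_ge0 => ? _.
move=> z h zh.
pose u (t : R) := f (z + t *: h).
pose v (t : R) := \sum_i h 0 i * partial i f (z + t *: h).
pose w (t : R) := \sum_j h 0 j * \sum_i h 0 i * partial i (partial j f) (z + t *: h).
have du (t : R) : is_derive t 1 u (v t) by exact: is_derive_line.
have dv (t : R) : is_derive t 1 v (w t).
  have -> : v = \sum_j (fun t : R => h 0 j *: partial j f (z + t *: h)).
    by apply/funext => a; rewrite fct_sumE.
  apply: is_derive_sum => j; apply: is_deriveZ.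
  exact/is_derive_line/smooth_partial.
have ct (p q : R -> R) (A : set R) : (forall t : R, is_derive t 1 p (q t)) ->
    {within A, continuous p}.
  move=> pq; apply: continuous_subspaceT => t.
  apply: differentiable_continuous; apply/derivable1_diffP.
  exact: (@ex_derive _ _ _ _ _ _ _ (pq t)).
have [c c01 uc] := @MVT_segment R u v 0 1 ler01 (fun t _ => du t) (ct _ _ _ du).
have c0 : 0 <= c by move: c01; rewrite in_itv /= => /andP[].
have c1 : c <= 1 by move: c01; rewrite in_itv /= => /andP[].
have [d d0c vd] := @MVT_segment R v w 0 c c0 (fun t _ => dv t) (ct _ _ _ dv).
have d0 : 0 <= d by move: d0c; rewrite in_itv /= => /andP[].
have d1 : d <= 1 by move: d0c; rewrite in_itv /= => /andP[_ /le_trans]; exact.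
(* The two mean values give [u 1 - u 0 = v c] and [v c - v 0 = w d * c]. *)
have -> : f (z + h) - f z - \sum_i h 0 i * partial i f z = w d * c.
  move: uc vd; rewrite /u scale0r scale1r addr0 subr0 mulr1 => ->.
  rewrite subr0 => <-; congr (_ - _).
  by apply: eq_bigr => i _; rewrite scale0r addr0.
rewrite normrM (ger0_norm c0).
apply: (@le_trans _ _ (`|w d| * 1)); first exact: ler_wpM2l.
rewrite mulr1 /w mulr_suml; apply: (le_trans (ler_norm_sum _ _ _)).
apply: ler_sum => j _; rewrite mulr_suml mulr_sumr.
apply: (le_trans (ler_norm_sum _ _ _)); apply: ler_sum => i _.
have Mij : `|partial i (partial j f) (z + d *: h)| <= M (i, j).
  apply: (MP (i, j)); apply: le_trans (ler_normD _ _) _.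
  apply: le_trans zh; rewrite lerD2l normrZ (ger0_norm d0).
  by rewrite ler_piMl.
rewrite !normrM mulrA [leLHS]mulrC expr2.
apply: ler_pM; [exact: normr_ge0|exact: mulr_ge0|exact: Mij|].
by apply: ler_pM; rewrite ?normr_ge0 ?norm_coord_le.
Qed.

End Smooth.

(** * Hadamard's lemma *)

Section Hadamard.
Context {R : realType}.
Implicit Types (f g : fn R) (x y z h : pt R) (i j k : 'I_3) (s : seq 'I_3).

(** A quadratic error is negligible against [h], so the linear form with coefficients [p] is the
    differential, by its uniqueness. *)
Lemma differentiable_quadratic f x (p : 'I_3 -> R) (C : R) :
  (forall h, `|h| <= 1 ->
     `|f (x + h) - f x - \sum_i h 0 i * p i| <= C * `|h| ^+ 2) ->
  differentiable f x /\ forall i, partial i f x = p i.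
Proof.
move=> fC.
pose l (h : 'rV[R]_3) : R := \sum_i h 0 i * p i.
have lin_l : linear l.
  move=> a u v; rewrite -[RHS]/(a * l u + l v) /l mulr_sumr -big_split /=.
  by apply: eq_bigr => i _; rewrite !mxE; ring.
pose lM := GRing.isLinear.Build _ _ _ _ l lin_l.
pose L : {linear 'rV[R]_3 -> R} := HB.pack l lM.
have cL : continuous L.
  apply: bounded_linear_continuous.
  apply/linear_boundedP; exists (\sum_i `|p i|); split; first exact: num_real.
  move=> M pM h; apply: le_trans (ler_norm_sum _ _ _) _.
  apply: (@le_trans _ _ ((\sum_i `|p i|) * `|h|)); last first.
    by apply: ler_wpM2r => //; exact: ltW.
  rewrite mulr_suml; apply: ler_sum => i _.
  by rewrite normrM mulrC ler_wpM2l// norm_coord_le.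
have Lo : f \o shift x = cst (f x) + L +o_ (0 : 'rV[R]_3) id.
  apply/eqaddoP => _/posnumP[e].
  (* [C] may be zero or negative; [|C| + 1] is a positive majorant. *)
  have e0 : 0 < e%:num / (`|C| + 1) by rewrite divr_gt0// ltr_wpDl.
  near=> h.
  have h1 : `|h| <= 1.
    by near: h; apply: filterS (nbhs0_le (@ltr01 R)) => h.
  have he : C * `|h| <= e%:num.
    have : `|h| <= e%:num / (`|C| + 1) by near: h; apply: filterS (nbhs0_le e0) => h.
    rewrite ler_pdivlMr ?ltr_wpDl// => hC; apply: le_trans hC.
    rewrite mulrC; apply: ler_wpM2l => //.
    by rewrite (le_trans (ler_norm _))// lerDl.
  have -> : (f \o shift x - (cst (f x) + L)) h = f (x + h) - f x - \sum_i h 0 i * p i.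
    by rewrite -[LHS]/(f (h + x) - (f x + l h)) opprD addrA (addrC h).
  apply: le_trans (fC _ h1) _.
  by rewrite expr2 mulrA ler_wpM2r.
have dE := diff_unique cL Lo.
have df : differentiable f x.
  by apply/diff_locallyP; rewrite dE.
split => // i; rewrite /partial deriveE// dE /=.
rewrite /l (bigD1 i)//= big1 ?addr0 ?mxE ?eqxx ?mul1r//.
by move=> j ji; rewrite mxE eqxx (negbTE ji) mul0r.
Unshelve. all: by end_near. Qed.

(** * Integrals of continuous functions over the unit interval *)

Lemma continuous_fun_mul (u v : R -> R) : continuous u -> continuous v ->
  continuous (fun t : R => u t * v t).
Proof. by move=> cu cv t; apply: (@continuousM _ _ u v); [exact: cu|exact: cv]. Qed.

Lemma continuous_fun_add (u v : R -> R) : continuous u -> continuous v ->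
  continuous (fun t : R => u t + v t).
Proof. by move=> cu cv t; apply: (@continuousD _ _ _ u v); [exact: cu|exact: cv]. Qed.

Lemma continuous_fun_sub (u v : R -> R) : continuous u -> continuous v ->
  continuous (fun t : R => u t - v t).
Proof. by move=> cu cv t; apply: (@continuousB _ _ _ u v); [exact: cu|exact: cv]. Qed.

Lemma integrable01 (u : R -> R) : continuous u ->
  (@lebesgue_measure R).-integrable `[0, 1] (EFin \o u).
Proof.
move=> cu; apply: continuous_compact_integrable; first exact: segment_compact.
exact: continuous_subspaceT.
Qed.

Lemma Rintegral01_sum (u : 'I_3 -> R -> R) : (forall i, continuous (u i)) ->
  (\int[lebesgue_measure]_(t in `[0, 1]) \sum_i u i t =
   \sum_i \int[lebesgue_measure]_(t in `[0, 1]) u i t)%R /\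
  continuous (fun t : R => \sum_i u i t).
Proof.
move=> cu.
have E : (fun t => \sum_i u i t) =
    fun t => u ord0 t + (u (lift ord0 ord0) t + u (lift ord0 (lift ord0 ord0)) t).
  by apply/funext => t; rewrite !big_ord_recl big_ord0 addr0.
have c12 := continuous_fun_add (cu (lift ord0 ord0)) (cu (lift ord0 (lift ord0 ord0))).
split; last by rewrite E; exact: continuous_fun_add.
under eq_Rintegral do rewrite !big_ord_recl big_ord0 addr0.
rewrite !big_ord_recl big_ord0 addr0.
rewrite RintegralD//; [|exact: integrable01|exact: (integrable01 c12)].
by rewrite RintegralD//; exact: integrable01.
Qed.

(** * Radial integrals and Hadamard's decomposition *)

(** Differentiating [f (y + t *: (x - y))] in [x] brings out a factor [t]; the weight [t ^+ n] makes
    the family stable under partial derivatives. *)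
Definition radial_integral (n : nat) y f : fn R := fun x =>
  \int[lebesgue_measure]_(t in `[0, 1]) (t ^+ n * f (y + t *: (x - y))).

Lemma continuous_radial n y x f : smooth f ->
  continuous (fun t : R => t ^+ n * f (y + t *: (x - y))).
Proof.
move=> sf; apply: continuous_fun_mul; first exact: exprn_continuous.
move=> t; have dl := is_derive_line y (x - y) t sf.
apply: differentiable_continuous; apply/derivable1_diffP.
exact: (@ex_derive _ _ _ _ _ _ _ dl).
Qed.

Lemma Rintegral01_norm_le (u : R -> R) (C : R) : continuous u ->
  (forall t, 0 <= t <= 1 -> `|u t| <= C) ->
  `|\int[lebesgue_measure]_(t in `[0, 1]) u t| <= C.
Proof.
move=> cu uC.
apply: (le_trans (le_normr_Rintegral _ (integrable01 cu))) => //.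
apply: (@le_trans _ _ (\int[lebesgue_measure]_(t in `[0, 1]) C)).
  apply: le_Rintegral => //.
  - apply: (integrable01 (u := fun t => `|u t|)) => t.
    by apply: continuous_comp; [exact: cu|exact: norm_continuous].
  - by apply: (integrable01 (u := fun _ => C)) => t; exact: cst_continuous.
rewrite Rintegral_cst//= lebesgue_measure_itv/= lte_fin ltr01/= subr0 mulr1.
exact: lexx.
Qed.

(** Differentiation under the integral sign: the Taylor remainder is bounded by [M * |h| ^+ 2]
    uniformly in [t], and so is its integral over [0, 1]. *)
Lemma radial_integral_diff n y f x : smooth f ->
  differentiable (radial_integral n y f) x /\
  forall i, partial i (radial_integral n y f) x =
            radial_integral n.+1 y (partial i f) x.
Proof.
(* This radius dominates [|z t| + |t *: h|] for all [t] in [0, 1] and [|h| <= 1]. *)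
move=> sf; pose r : R := `|y| + `|x - y| + 1.
have r0 : 0 <= r by rewrite !addr_ge0.
have [M M0 MP] := taylor_quadratic r0 sf.
apply: (@differentiable_quadratic _ _ _ M) => h h1.
pose z (t : R) : pt R := y + t *: (x - y).
pose e t : R := t ^+ n * (f (z t + t *: h) - f (z t) -
  \sum_i (t *: h) 0 i * partial i f (z t)).
have cr n' x' f' := @continuous_radial n' y x' f'.
have zt t : y + t *: (x + h - y) = z t + t *: h.
  by rewrite /z -[RHS]addrA -scalerDr addrAC.
have ci i : continuous (fun t : R => h 0 i * (t ^+ n.+1 * partial i f (z t))).
  apply: continuous_fun_mul; first by move=> ?; exact: cst_continuous.
  exact/cr/smooth_partial.
have [isum csum] := Rintegral01_sum ci.
have eE : e = fun t : R => t ^+ n * f (y + t *: (x + h - y)) - t ^+ n * f (z t) -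
     \sum_i h 0 i * (t ^+ n.+1 * partial i f (z t)).
  apply/funext => t; rewrite /= zt /e mulrBr mulrBr; congr (_ - _).
  rewrite mulr_sumr; apply: eq_bigr => i _; rewrite mxE exprS.
  by ring.
have c1 : continuous (fun t : R =>
    t ^+ n * f (y + t *: (x + h - y)) - t ^+ n * f (z t)).
  by apply: continuous_fun_sub; exact: cr.
have -> : radial_integral n y f (x + h) - radial_integral n y f x -
    \sum_i h 0 i * radial_integral n.+1 y (partial i f) x =
    \int[lebesgue_measure]_(t in `[0, 1]) e t.
  rewrite eE RintegralB//; [|exact: integrable01 c1|exact: integrable01].
  rewrite RintegralB//; try exact/integrable01/cr.
  congr (_ - _); rewrite isum; apply: eq_bigr => i _.
  rewrite RintegralZl//; apply: integrable01; exact/cr/smooth_partial.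
apply: Rintegral01_norm_le.
  by rewrite eE; exact: continuous_fun_sub.
move=> t /andP[t0 t1]; rewrite /e normrM.
have th : `|t *: h| <= `|h| by rewrite normrZ (ger0_norm t0) ler_piMl.
apply: (@le_trans _ _ (1 * (M * `|t *: h| ^+ 2))).
  apply: ler_pM => //; first by rewrite normrX exprn_ile1// ger0_norm.
  apply: MP; rewrite /r /z; apply: lerD; last exact: le_trans th h1.
  apply: le_trans (ler_normD _ _) _; rewrite lerD2l normrZ (ger0_norm t0).
  by rewrite ler_piMl.
by rewrite mul1r ler_wpM2l// lerXn2r ?nnegrE.
Qed.

Lemma smooth_radial_integral n y f : smooth f -> smooth (radial_integral n y f).
Proof.
move=> sf; apply: (@smooth_coind _ (fun u =>
  exists m g, smooth g /\ u = radial_integral m y g)).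
- by move=> _ [m [g [sg ->]]] x; have [] := radial_integral_diff m y x sg.
- move=> _ i [m [g [sg ->]]]; exists m.+1, (partial i g).
  split; first exact: smooth_partial.
  by apply/funext => x; have [_ ->] := radial_integral_diff m y x sg.
- by exists n, f.
Qed.

(** The fundamental theorem of calculus on the segment from [y] to [x] writes [f x - f y] as the
    integral of its derivative; [g i] is the mean of [partial i f] over that segment. *)
Lemma hadamard f y : smooth f -> exists g : 'I_3 -> fn R,
  [/\ forall i, smooth (g i),
      forall i, g i y = partial i f y &
      forall x, f x = f y + \sum_i (x 0 i - y 0 i) * g i x].
Proof.
move=> sf; exists (fun i => radial_integral 0 y (partial i f)); split.
- by move=> i; exact/smooth_radial_integral/smooth_partial.
- move=> i; rewrite /radial_integral.
  under eq_Rintegral do rewrite subrr scaler0 addr0 expr0 mul1r.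
  by rewrite Rintegral_cst//= lebesgue_measure_itv/= lte_fin ltr01/= subr0 mulr1.
move=> x; apply/eqP; rewrite addrC -subr_eq; apply/eqP.
pose z (t : R) : pt R := y + t *: (x - y).
have dz t := is_derive_line y (x - y) t sf.
have ci i : continuous (fun t : R => (x 0 i - y 0 i) * (t ^+ 0 * partial i f (z t))).
  apply: continuous_fun_mul; first by move=> ?; exact: cst_continuous.
  exact/continuous_radial/smooth_partial.
have [isum csum] := Rintegral01_sum ci.
have -> : \sum_i (x 0 i - y 0 i) * radial_integral 0 y (partial i f) x =
    \int[lebesgue_measure]_(t in `[0, 1])
      \sum_i (x 0 i - y 0 i) * (t ^+ 0 * partial i f (z t)).
  rewrite isum; apply: eq_bigr => i _.
  rewrite RintegralZl//; apply: integrable01.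
  exact/continuous_radial/smooth_partial.
rewrite /Rintegral (@continuous_FTC2 _ _ (fun t => f (z t)))//=.
- by rewrite /z scale1r scale0r addr0 (addrC y) subrK.
- exact: continuous_subspaceT.
- have cz t : {for t, continuous (fun t : R => f (z t))}.
    apply: differentiable_continuous; apply/derivable1_diffP.
    exact: (@ex_derive _ _ _ _ _ _ _ (dz t)).
  split.
  + by move=> t _; exact: (@ex_derive _ _ _ _ _ _ _ (dz t)).
  + exact: cvg_at_right_filter (cz 0).
  + exact: cvg_at_left_filter (cz 1).
- move=> t _; rewrite derive1E (@derive_val _ _ _ _ _ _ _ (dz t)).
  by apply: eq_bigr => i _; rewrite !mxE expr0 mul1r.
Qed.

(* Differentiating the Hadamard decomposition twice at [y] gives
   [partial j g_i y + partial i g_j y]. *)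
Lemma partialC i j f : smooth f ->
  partial i (partial j f) = partial j (partial i f).
Proof.
move=> sf; apply/funext => y.
have [g [sg _ fg]] := hadamard y sf.
have sX k : smooth (fun x : pt R => x 0 k - y 0 k).
  by apply: smooth_sub; [exact: smooth_coord|exact: smooth_cst].
have pX k l : partial k (fun x : pt R => x 0 l - y 0 l) = (fun _ => (k == l)%:R).
  rewrite partialD; [|exact: smooth_coord|exact: smooth_cst].
  by rewrite partial_coord partial_cst; apply/funext => x; rewrite addr0.
suff H k l : partial k (partial l f) y = partial k (g l) y + partial l (g k) y.
  by rewrite !H addrC.
have pf : partial l f = fun x => g l x + \sum_m (x 0 m - y 0 m) * partial l (g m) x.
  have -> : f = fun x => f y + \sum_m (x 0 m - y 0 m) * g m x by apply/funext.
  rewrite partialD; [|exact: smooth_cst|]; last first.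
    by apply: smooth_sum => m; exact: smooth_mul.
  rewrite partial_cst partial_sum; last by move=> m; exact: smooth_mul.
  apply/funext => x; rewrite add0r.
  under eq_bigr do rewrite partialM// pX.
  rewrite big_split /= addrC; congr (_ + _).
  rewrite (bigD1 l)//= eqxx mul1r big1 ?addr0// => m ml.
  by rewrite eq_sym (negbTE ml) mul0r.
rewrite pf partialD//; last first.
  by apply: smooth_sum => m; apply: smooth_mul => //; exact: smooth_partial.
congr (_ + _).
have sp m : smooth (partial l (g m)) by exact: smooth_partial.
rewrite partial_sum; last by move=> m; exact: smooth_mul.
under eq_bigr do rewrite partialM// pX subrr mul0r add0r.
rewrite (bigD1 k)//= eqxx mul1r big1 ?addr0// => m mk.
by rewrite eq_sym (negbTE mk) mul0r.
Qed.

End Hadamard.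

(** * Biderivations *)

Section Biderivations.
Context {R : realType}.
Implicit Types (f g a b c phi : fn R) (x y z h : pt R) (i j k : 'I_3) (s : seq 'I_3).

Definition coord_fn i : fn R := fun x => x 0 i.

(** The Leibniz rule kills constants. On the Hadamard decomposition at [y], the factors
    [x 0 i - y 0 i] vanish at [y], so only [v (coord_fn i) * g i y] survives, and [g i y] is the
    partial derivative. *)
Lemma point_derivationE (v : fn R -> R) y :
  (forall (l : R) a b, smooth a -> smooth b ->
     v (fun x => l * a x + b x) = l * v a + v b) ->
  (forall a b, smooth a -> smooth b -> v (a \* b) = a y * v b + v a * b y) ->
  forall f, smooth f -> v f = \sum_i v (coord_fn i) * partial i f y.
Proof.
move=> vlin vM.
have vD a b : smooth a -> smooth b -> v (fun x => a x + b x) = v a + v b.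
  move=> sa sb; rewrite -[v a]mul1r -vlin//.
  by congr v; apply/funext => x; rewrite mul1r.
have v0 : v (fun _ => 0) = 0.
  have := vD _ _ (smooth_cst 0) (smooth_cst 0).
  under [X in v X = _]eq_fun do rewrite addr0.
  by move/eqP; rewrite -subr_eq0 opprD addrA subrr sub0r oppr_eq0 => /eqP.
have vC (l : R) : v (fun _ => l) = 0.
  have v1 : v (fun _ => 1) = 0.
    have := vM _ _ (smooth_cst 1) (smooth_cst 1).
    rewrite (_ : _ \* _ = fun _ => 1); last by apply/funext => x /=; rewrite mulr1.
    rewrite mul1r mulr1 => /eqP.
    by rewrite -subr_eq0 opprD addrA subrr sub0r oppr_eq0 => /eqP.
  transitivity (v (fun x => l * (fun _ => 1) x + (fun _ => 0) x)).
    by congr v; apply/funext => x; rewrite mulr1 addr0.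
  by rewrite vlin ?v1 ?v0 ?mulr0 ?addr0//; exact: smooth_cst.
have vS (r : seq 'I_3) (u : 'I_3 -> fn R) : (forall i, smooth (u i)) ->
    v (fun x => \sum_(i <- r) u i x) = \sum_(i <- r) v (u i).
  move=> su; elim: r => [|i r ih].
    by under eq_fun do rewrite big_nil; rewrite big_nil.
  under eq_fun do rewrite big_cons.
  by rewrite vD ?ih ?big_cons//; exact: smooth_sum.
move=> f /(hadamard y)[g [sg gy fg]].
have sX i : smooth (fun x : pt R => x 0 i - y 0 i).
  by apply: smooth_sub; [exact: smooth_coord|exact: smooth_cst].
have -> : f = fun x => f y + \sum_i (x 0 i - y 0 i) * g i x by apply/funext.
rewrite vD; [|exact: smooth_cst|by apply: smooth_sum => i; exact: smooth_mul].
rewrite vC add0r vS; last by move=> i; exact: smooth_mul.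
(* The decomposition was also substituted inside the partial derivatives on the right; it is folded
   back there. *)
have -> : (fun x => f y + \sum_i (x 0 i - y 0 i) * g i x) = f.
  by apply/funext => x; rewrite -fg.
apply: eq_bigr => i _.
rewrite (vM (fun x : pt R => x 0 i - y 0 i) (g i))// subrr mul0r add0r gy.
by rewrite vD ?vC ?addr0//; [exact: smooth_coord|exact: smooth_cst].
Qed.

Definition bivector (q : 'I_3 -> 'I_3 -> fn R) a b : fn R :=
  fun x => \sum_i \sum_j q i j x * partial i a x * partial j b x.

(** With one argument frozen, evaluation at a point is a point derivation in the first slot;
    skewness carries this over to the second slot. *)
Lemma skew_biderivationE F a b : skew_biderivation F -> smooth a -> smooth b ->
  F a b = bivector (fun i j => F (coord_fn i) (coord_fn j)) a b.
Proof.
move=> [_ Fskew Flin FM] sa sb; apply/funext => y.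
have E b' (sb' : smooth b') a' (sa' : smooth a') :
    F a' b' y = \sum_i F (coord_fn i) b' y * partial i a' y.
  apply: (@point_derivationE (fun a' => F a' b' y) y) => //.
  - by move=> l a1 a2 sa1 sa2; rewrite Flin.
  - by move=> a1 a2 sa1 sa2; rewrite FM.
rewrite E// /bivector; apply: eq_bigr => i _.
rewrite Fskew//; last exact: smooth_coord.
rewrite E//; last exact: smooth_coord.
rewrite mulNr mulr_suml -sumrN; apply: eq_bigr => j _.
rewrite [F (coord_fn i) _]Fskew; [|exact: smooth_coord|exact: smooth_coord].
by ring.
Qed.

(** * The Pluecker relation and rescaled Poisson brackets *)

Lemma sum_ord3 (u : 'I_3 -> R) : \sum_i u i =
  u ord0 + (u (lift ord0 ord0) + u (lift ord0 (lift ord0 ord0))).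
Proof. by rewrite !big_ord_recl big_ord0 addr0. Qed.

(* In dimension 3 every bivector [q] satisfies [q /\ q = 0]. *)
Lemma bivector_pluecker (q : 'I_3 -> 'I_3 -> R) (a b c p : 'I_3 -> R) :
  (forall i j, q i j = - q j i) ->
  let Q u v := \sum_i \sum_j q i j * u i * v j in
  Q a p * Q b c + Q b p * Q c a + Q c p * Q a b = 0.
Proof.
move=> sk Q.
have sk0 i : q i i = 0 by have := sk i i; lra.
have QE u v : Q u v =
    q ord0 (lift ord0 ord0) *
      (u ord0 * v (lift ord0 ord0) - u (lift ord0 ord0) * v ord0) +
    q ord0 (lift ord0 (lift ord0 ord0)) *
      (u ord0 * v (lift ord0 (lift ord0 ord0)) -
       u (lift ord0 (lift ord0 ord0)) * v ord0) +
    q (lift ord0 ord0) (lift ord0 (lift ord0 ord0)) *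
      (u (lift ord0 ord0) * v (lift ord0 (lift ord0 ord0)) -
       u (lift ord0 (lift ord0 ord0)) * v (lift ord0 ord0)).
  rewrite /Q !sum_ord3 !sk0 (sk (lift ord0 ord0) ord0).
  rewrite (sk (lift ord0 (lift ord0 ord0)) ord0).
  by rewrite (sk (lift ord0 (lift ord0 ord0)) (lift ord0 ord0)); ring.
by rewrite !QE; ring.
Qed.

Lemma biderivation_pluecker F a b c phi x : skew_biderivation F ->
  smooth a -> smooth b -> smooth c -> smooth phi ->
  F a phi x * F b c x + F b phi x * F c a x + F c phi x * F a b x = 0.
Proof.
move=> bF sa sb sc sp; rewrite !(skew_biderivationE bF)//.
have [_ Fskew _ _] := bF.
apply: (@bivector_pluecker (fun i j => F (coord_fn i) (coord_fn j) x)
  (fun i => partial i a x) (fun i => partial i b x)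
  (fun i => partial i c x) (fun i => partial i phi x)) => i j.
by rewrite [in LHS]Fskew//; exact: smooth_coord.
Qed.

(** By Leibniz in the second slot, the Jacobi sum of [phi F] is [phi^2] times that of [F] plus [phi]
    times the Pluecker sum of [F(a,phi) F(b,c)]. *)
Lemma poisson_scal F phi : poisson F -> smooth phi -> poisson (scal phi F).
Proof.
move=> [bF FJ] sp; have [Fs Fskew Flin FM] := bF.
have FMr a b c : smooth a -> smooth b -> smooth c ->
    F a (b \* c) = (fun x => b x * F a c x + F a b x * c x).
  move=> sa sb sc; rewrite Fskew//; last exact: smooth_mul.
  rewrite FM// [F a c]Fskew// [F a b]Fskew//; apply/funext => x /=; ring.
split.
- split.
  + by move=> a b sa sb; apply: smooth_mul => //; exact: Fs.
  + by move=> a b sa sb; apply/funext => x; rewrite /scal Fskew// mulrN.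
  + by move=> l a b c sa sb sc; apply/funext => x; rewrite /scal Flin//; ring.
  + by move=> a b c sa sb sc; apply/funext => x; rewrite /scal FM//; ring.
- move=> a b c sa sb sc; apply/funext => x; rewrite /scal.
  have sF u v : smooth u -> smooth v -> smooth (F u v) by exact: Fs.
  rewrite !(FMr _ phi); try by [|exact: sF].
  have /(congr1 (fun u => u x)) /= J := FJ _ _ _ sa sb sc.
  have P := biderivation_pluecker x bF sa sb sc sp.
  (* Zero is written as [phi^2] times the Jacobi sum plus [phi] times the Pluecker sum, which leaves
     a ring identity. *)
  rewrite -[RHS](mulr0 (phi x * phi x)) -J -[RHS]addr0 -[in RHS](mulr0 (phi x)).
  by rewrite -P; ring.
Qed.

End Biderivations.

(** * Bidifferential operators *)

Section Diff2.
Context {R : realType}.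
Implicit Types (f g a b c phi : fn R) (x y z h : pt R) (i j : 'I_3) (s t : seq 'I_3).
Implicit Types F G : fn R -> fn R -> fn R.

Lemma eq_diff2 F G : (forall a b, smooth a -> smooth b -> F a b = G a b) ->
  diff2 F -> diff2 G.
Proof.
move=> FG [N [c [s [t [sc FE]]]]]; exists N, c, s, t; split=> // a b sa sb.
by rewrite -FG// FE.
Qed.

(** Arbitrary finite index types let sums of operators be indexed by disjoint unions, without
    arithmetic on ordinals. *)
Lemma diff2_fin (I : finType) (c : I -> fn R) (s t : I -> seq 'I_3) :
  (forall m, smooth (c m)) ->
  diff2 (fun a b x => \sum_m c m x * dpow (s m) a x * dpow (t m) b x).
Proof.
move=> sc; exists #|I|, (c \o enum_val), (s \o enum_val), (t \o enum_val).
split=> [k|a b sa sb]; first exact: sc.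
apply/funext => x; rewrite (reindex (@enum_val I I))//=.
exact/onW_bij/enum_val_bij.
Qed.

Lemma diff2_monomial c s t : smooth c ->
  diff2 (fun a b x => c x * dpow s a x * dpow t b x).
Proof.
move=> sc.
apply: eq_diff2 (@diff2_fin unit (fun _ => c) (fun _ => s) (fun _ => t) _) => //.
move=> a b _ _; apply/funext => x.
by rewrite (big_pred1 tt)// => -[].
Qed.

Lemma diff2_add F G : diff2 F -> diff2 G -> diff2 (fun a b x => F a b x + G a b x).
Proof.
move=> [N [c [s [t [sc FE]]]]] [M [d [u [v [sd GE]]]]].
pose cs (T : Type) (f : 'I_N -> T) (g : 'I_M -> T) (k : 'I_N + 'I_M) :=
  match k with inl k => f k | inr k => g k end.
apply: eq_diff2 (@diff2_fin ('I_N + 'I_M)%type (cs _ c d) (cs _ s u) (cs _ t v) _).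
  by move=> a b sa sb; apply/funext => x; rewrite big_sumType FE// GE.
by case.
Qed.

Lemma diff2_sum (I : Type) (r : seq I) (F : I -> fn R -> fn R -> fn R) :
  (forall m, diff2 (F m)) -> diff2 (fun a b x => \sum_(m <- r) F m a b x).
Proof.
move=> dF; elim: r => [|m r ih].
  exists 0, (fun _ _ => 0), (fun _ => [::]), (fun _ => [::]); split.
    by move=> k; exact: smooth_cst.
  by move=> a b _ _; apply/funext => x; rewrite big_nil big_ord0.
apply: eq_diff2 (diff2_add (dF m) ih) => a b _ _; apply/funext => x.
by rewrite big_cons.
Qed.

Lemma diff2_scal c F : smooth c -> diff2 F -> diff2 (scal c F).
Proof.
move=> sc [N [d [s [t [sd FE]]]]].
exists N, (fun k x => c x * d k x), s, t; split.
  by move=> k; exact: smooth_mul.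
move=> a b sa sb; apply/funext => x; rewrite /scal FE// mulr_sumr.
by apply: eq_bigr => k _; rewrite !mulrA.
Qed.

Lemma diff2_swap F : diff2 F -> diff2 (fun a b => F b a).
Proof.
move=> [N [d [s [t [sd FE]]]]]; exists N, d, t, s; split => // a b sa sb.
by apply/funext => x; rewrite FE//; apply: eq_bigr => k _; rewrite mulrAC.
Qed.

Lemma diff2_smooth F a b : diff2 F -> smooth a -> smooth b -> smooth (F a b).
Proof.
move=> [N [d [s [t [sd FE]]]]] sa sb; rewrite FE//; apply: smooth_sum => k.
by apply: smooth_mul; [apply: smooth_mul => //|]; exact: smooth_dpow.
Qed.

Lemma diff2_partial i F : diff2 F -> diff2 (fun a b => partial i (F a b)).
Proof.
move=> [N [d [s [t [sd FE]]]]].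
pose G k a b x := partial i (d k) x * dpow (s k) a x * dpow (t k) b x +
  (d k x * dpow (i :: s k) a x * dpow (t k) b x +
   d k x * dpow (s k) a x * dpow (i :: t k) b x).
apply: (@eq_diff2 (fun a b x => \sum_(k < N) G k a b x)); last first.
  apply: diff2_sum => k; apply: diff2_add.
    by apply: diff2_monomial; exact: smooth_partial.
  by apply: diff2_add; exact: diff2_monomial.
move=> a b sa sb; rewrite FE//.
have sA k : smooth (dpow (s k) a) by exact: smooth_dpow.
have sB k : smooth (dpow (t k) b) by exact: smooth_dpow.
have sdA k : smooth (fun x => d k x * dpow (s k) a x) by exact: smooth_mul.
rewrite partial_sum; last by move=> k; exact: smooth_mul.
apply/funext => x; apply: eq_bigr => k _.
rewrite (@partialM _ _ (fun x => d k x * dpow (s k) a x))//.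
rewrite (@partialM _ _ (d k))// /G /=; ring.
Qed.

Lemma diff2_dpow s F : diff2 F -> diff2 (fun a b => dpow s (F a b)).
Proof. by move=> dF; elim: s => //= i s; exact: diff2_partial. Qed.

Lemma diff2_mul : diff2 (fun a b => a \* b).
Proof.
apply: eq_diff2 (diff2_monomial [::] [::] (smooth_cst 1)) => a b _ _.
by apply/funext => x; rewrite /= mul1r.
Qed.

(** With its first argument frozen at [phi], the outer [F] is a differential operator in one
    argument, with coefficients [d k * dpow (s k) phi]. *)
Lemma diff2_post F phi : diff2 F -> smooth phi -> diff2 (fun a b => F phi (F a b)).
Proof.
move=> dF sp; have [N [d [s [t [sd FE]]]]] := dF.
apply: (@eq_diff2 (fun a b x => \sum_(k < N)
  scal (fun x => d k x * dpow (s k) phi x) (fun a b => dpow (t k) (F a b)) a b x)).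
  by move=> a b sa sb; rewrite [RHS]FE//; exact: diff2_smooth.
apply: diff2_sum => k; apply: diff2_scal; last exact: diff2_dpow.
by apply: smooth_mul => //; exact: smooth_dpow.
Qed.

Lemma dpow_cat s t f : dpow (s ++ t) f = dpow s (dpow t f).
Proof. by rewrite /dpow foldr_cat. Qed.

(** Permutations are generated by exchanges of adjacent blocks, and those follow from moving one
    partial derivative at a time with [partialC]. *)
Lemma dpow_perm s t f : smooth f -> perm_eq s t -> dpow s f = dpow t f.
Proof.
move=> sf; move: s t; apply: (catCA_perm_subst (F := fun s => dpow s f)) => u v w.
rewrite !dpow_cat.
have {sf} : smooth (dpow w f) by exact: smooth_dpow.
move: (dpow w f) => g {}sf.
have C i r e : smooth e -> partial i (dpow r e) = dpow r (partial i e).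
  move=> se; elim: r => //= j r ih.
  by rewrite partialC ?ih//; exact: smooth_dpow.
elim: u g sf => //= i u ih g sg.
by rewrite ih// C//; exact: smooth_dpow.
Qed.

End Diff2.

(** * Polynomial identities *)

(** A nonzero [p] would have the [size p] distinct roots 0, 1, 2, ..., more than its degree
    allows. *)
Lemma poly_fun_eq0 (R : numFieldType) (p : {poly R}) :
  (forall t, p.[t] = 0) -> p = 0.
Proof.
move=> p0; apply/eqP/negPn/negP => pn0.
have : (size [seq n%:R : R | n <- iota 0 (size p)] < size p)%N.
  apply: max_poly_roots => //.
    by apply/allP => _ /mapP[n _ ->]; rewrite rootE p0.
  by rewrite map_inj_uniq ?iota_uniq//; exact: mulrIn (oner_neq0 R).
by rewrite size_map size_iota ltnn.
Qed.

(** Each coefficient of the vanishing polynomial is the sum of the [c k] of one exponent, and [W] is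
    constant on such a group. With [t] a scaling parameter, this separates homogeneous parts and
    reweights them by degree. *)
Lemma sum_coef_eq0 (R : numFieldType) (N : nat) (c W : 'I_N -> R)
    (n : 'I_N -> nat) :
  (forall t : R, \sum_k c k * t ^+ n k = 0) ->
  (forall k l, n k = n l -> W k = W l) -> \sum_k c k * W k = 0.
Proof.
move=> c0 nW.
have p0 : \sum_k c k *: 'X^(n k) = 0 :> {poly R}.
  apply: poly_fun_eq0 => t; rewrite horner_sum -[RHS](c0 t).
  by apply: eq_bigr => k _; rewrite hornerZ hornerXn.
pose B := (\max_k n k).+1.
have nB k : (n k < B)%N by rewrite ltnS; exact: leq_bigmax.
rewrite (partition_big (fun k => Ordinal (nB k)) xpredT)//=.
rewrite big1// => m _.
have cm : \sum_(k | Ordinal (nB k) == m) c k = 0.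
  have := congr1 (fun p : {poly R} => p`_m) p0; rewrite coef0 coef_sum.
  apply: etrans; rewrite big_mkcond; apply: eq_bigr => k _.
  by rewrite coefZ coefXn -val_eqE/= eq_sym; case: eqP; rewrite ?mulr1 ?mulr0.
case: (pickP (fun k => Ordinal (nB k) == m)) => [l /eqP lm|no]; last first.
  by rewrite big1// => k; rewrite no.
rewrite (eq_bigr (fun k => c k * W l)).
  by rewrite -mulr_suml cm mul0r.
by move=> k /eqP km; congr (_ * _); apply: nW; move: lm; rewrite -km => /(congr1 val).
Qed.

(** * Monomials and Kronecker's substitution *)

Definition monomial (R : pzSemiRingType) (s : seq 'I_3) (xi : 'rV[R]_3) : R :=
  \prod_(i <- s) xi 0 i.

Lemma monomial_scale (R : comPzRingType) s (t : R) xi :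
  monomial s (t *: xi) = t ^+ size s * monomial s xi.
Proof.
rewrite /monomial; under eq_bigr do rewrite mxE.
rewrite big_split /=; congr (_ * _).
elim: s => [|i s ih]; first by rewrite big_nil.
by rewrite big_cons ih exprS.
Qed.

Lemma monomial_cat (R : pzSemiRingType) s t (xi : 'rV[R]_3) :
  monomial (s ++ t) xi = monomial s xi * monomial t xi.
Proof. by rewrite /monomial big_cat. Qed.

Section Kronecker.
Variable B : nat.

(** For [s] shorter than [B], this is the number whose base [B] digits are the multiplicities of the
    three indices in [s]. *)
Definition kronecker (s : seq 'I_3) : nat := \sum_(i <- s) B ^ i.

Lemma kroneckerE s : kronecker s =
  (count_mem ord0 s + B * (count_mem (lift ord0 ord0) s +
   B * count_mem (lift ord0 (lift ord0 ord0)) s))%N.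
Proof.
elim: s => [|i s ih]; first by rewrite /kronecker big_nil /= !muln0.
rewrite /kronecker big_cons -/(kronecker s) ih /=.
by case: i => -[|[|[|//]]] ? /=; rewrite ?expn0 ?expn1 ?expnS; ring.
Qed.

Lemma digit_inj a q a' q' : (a < B)%N -> (a' < B)%N ->
  (a + B * q = a' + B * q')%N -> a = a' /\ q = q'.
Proof.
move=> aB a'B E; have B0 : (0 < B)%N by exact: leq_ltn_trans aB.
have := congr1 (modn^~ B) E; have := congr1 (divn^~ B) E.
rewrite ![(_ + B * _)%N]addnC ![(B * _)%N]mulnC !divnMDl// !modnMDl.
by rewrite !divn_small// !modn_small// !addn0.
Qed.

Lemma kronecker_inj s t s' t' :
  (size s < B)%N -> (size t < B)%N -> (size s' < B)%N -> (size t' < B)%N ->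
  (kronecker s + B ^ 3 * kronecker t = kronecker s' + B ^ 3 * kronecker t')%N ->
  perm_eq s s' /\ perm_eq t t'.
Proof.
move=> sB tB sB' tB'.
have cB r p : (size r < B)%N -> (count p r < B)%N.
  by apply: leq_ltn_trans; exact: count_size.
rewrite !kroneckerE.
set s0 := count_mem _ s; set s1 := count_mem _ s; set s2 := count_mem _ s.
set t0 := count_mem _ t; set t1 := count_mem _ t; set t2 := count_mem _ t.
set u0 := count_mem _ s'; set u1 := count_mem _ s'; set u2 := count_mem _ s'.
set v0 := count_mem _ t'; set v1 := count_mem _ t'; set v2 := count_mem _ t'.
have E a b c q : (a + B * (b + B * c) + B ^ 3 * q =
    a + B * (b + B * (c + B * q)))%N by rewrite !expnS expn0; ring.
(* The six multiplicities are the digits of one number: five are peeled off, and the last quotient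
   is the sixth. *)
rewrite !E => /digit_inj[||e0]; [exact: cB|exact: cB|].
move=> /digit_inj[||e1]; [exact: cB|exact: cB|].
move=> /digit_inj[||e2]; [exact: cB|exact: cB|].
move=> /digit_inj[||e3]; [exact: cB|exact: cB|].
move=> /digit_inj[||e4 e5]; [exact: cB|exact: cB|].
have I3 (P : 'I_3 -> Prop) : P ord0 -> P (lift ord0 ord0) ->
    P (lift ord0 (lift ord0 ord0)) -> forall i, P i.
  move=> P0 P1 P2 i; case: (unliftP ord0 i) => [j ->|->//].
  case: (unliftP ord0 j) => [k ->|->//].
  by rewrite (ord1 k).
by split; apply/allP => i _; apply/eqP; move: i; exact: I3.
Qed.
End Kronecker.

(* Kronecker's substitution [xi_i = T ^ (B ^ i)], [eta_i = T ^ (B ^ (3 + i))]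
   reduces the statement to polynomials in the single variable [T]. *)
Lemma sum_monomial_eq0 (R : numFieldType) (N : nat) (c : 'I_N -> R)
    (s t : 'I_N -> seq 'I_3) (A A' : seq 'I_3 -> R) :
  (forall u v, perm_eq u v -> A u = A v) ->
  (forall u v, perm_eq u v -> A' u = A' v) ->
  (forall xi eta, \sum_k c k * monomial (s k) xi * monomial (t k) eta = 0) ->
  \sum_k c k * A (s k) * A' (t k) = 0.
Proof.
move=> pA pA' c0.
pose B := (\max_k maxn (size (s k)) (size (t k))).+1.
have sB k : (size (s k) < B)%N.
  rewrite ltnS; apply: (leq_trans (leq_maxl _ (size (t k)))).
  exact: (leq_bigmax (F := fun k => maxn (size (s k)) (size (t k)))).
have tB k : (size (t k) < B)%N.
  rewrite ltnS; apply: (leq_trans (leq_maxr (size (s k)) _)).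
  exact: (leq_bigmax (F := fun k => maxn (size (s k)) (size (t k)))).
under eq_bigr do rewrite -mulrA.
apply: (sum_coef_eq0 (n := fun k => (kronecker B (s k) + B ^ 3 * kronecker B (t k))%N)).
  move=> T.
  have K (r : seq 'I_3) (U : R) :
      monomial r (\row_(i < 3) U ^+ (B ^ i)%N) = U ^+ kronecker B r.
    rewrite /monomial /kronecker; under eq_bigr do rewrite mxE.
    elim: r => [|i r ih]; first by rewrite !big_nil.
    by rewrite !big_cons ih exprD.
  rewrite -[RHS](c0 (\row_(i < 3) T ^+ (B ^ i))
    (\row_(i < 3) (T ^+ (B ^ 3)) ^+ (B ^ i)%N)).
  by apply: eq_bigr => k _; rewrite !K -exprM -mulrA -exprD.
move=> k l /kronecker_inj[]// ps pt.
by rewrite (pA _ _ ps) (pA' _ _ pt).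
Qed.

(** * Symbols and symmetric cocycles *)

Section Symbols.
Context {R : realType}.
Implicit Types (a b : fn R) (x y z xi eta : pt R) (i j : 'I_3) (s t : seq 'I_3).
Implicit Types F S : fn R -> fn R -> fn R.

(** Exponentials normalised to 1 at [y]: the value of a bidifferential operator on [expf y xi],
    [expf y eta] at [y] is its full symbol there. *)
Definition expf y xi : fn R := fun x => expR (\sum_i xi 0 i * (x 0 i - y 0 i)).

Lemma expf_diff y xi x :
  differentiable (expf y xi) x /\
  forall i, partial i (expf y xi) x = xi 0 i * expf y xi x.
Proof.
pose l : fn R := fun x => \sum_i xi 0 i * (x 0 i - y 0 i).
have sl1 i : smooth (fun x : pt R => xi 0 i * (x 0 i - y 0 i)).
  apply: smooth_mul; first exact: smooth_cst.
  by apply: smooth_sub; [exact: smooth_coord|exact: smooth_cst].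
have sl : smooth l by exact: smooth_sum.
have pl i : partial i l x = xi 0 i.
  rewrite partial_sum// (bigD1 i)//= big1 ?addr0 => [|j ji].
    rewrite (@partialM _ i (fun _ => xi 0 i)); last 2 first.
    - exact: smooth_cst.
    - by apply: smooth_sub; [exact: smooth_coord|exact: smooth_cst].
    rewrite partial_cst mul0r addr0 partialD; last 2 first.
    - exact: smooth_coord.
    - exact: smooth_cst.
    by rewrite partial_coord partial_cst eqxx addr0 mulr1.
  rewrite (@partialM _ i (fun _ => xi 0 j)); last 2 first.
  - exact: smooth_cst.
  - by apply: smooth_sub; [exact: smooth_coord|exact: smooth_cst].
  rewrite partial_cst mul0r addr0 partialD; last 2 first.
  - exact: smooth_coord.
  - exact: smooth_cst.
  by rewrite partial_coord partial_cst eq_sym (negbTE ji) addr0 mulr0.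
have dl := smooth_differentiable x sl.
have de : differentiable (@expR R) (l x).
  by apply/derivable1_diffP; exact: derivable_expR.
have d : differentiable (@expR R \o l) x by exact: differentiable_comp.
split=> [//|i]; rewrite /partial deriveE// diff_comp//= diff1E//.
by rewrite derive1E derive_val -deriveE// -/(partial i l x) pl.
Qed.

Lemma partial_expf i y xi : partial i (expf y xi) = fun x => xi 0 i * expf y xi x.
Proof. by apply/funext => x; have [_ ->] := expf_diff y xi x. Qed.

Lemma partial_cmul_expf i y xi (c : R) :
  partial i (fun x => c * expf y xi x) = fun x => c * xi 0 i * expf y xi x.
Proof.
rewrite (@partial_mul _ i (fun _ => c)); last 2 first.
- by move=> x; exact: differentiable_cst.
- by move=> x; have [] := expf_diff y xi x.
by rewrite partial_cst partial_expf; apply/funext => x; rewrite mul0r addr0 mulrA.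
Qed.

Lemma smooth_expf y xi : smooth (expf y xi).
Proof.
apply: (@smooth_coind _ (fun u => exists c : R, u = fun x => c * expf y xi x)).
- move=> _ [c ->] x; apply: (@differentiableM _ _ (fun _ => c)).
    exact: differentiable_cst.
  by have [] := expf_diff y xi x.
- by move=> _ i [c ->]; exists (c * xi 0 i); exact: partial_cmul_expf.
- by exists 1; apply/funext => x; rewrite mul1r.
Qed.

Lemma dpow_expf s y xi : dpow s (expf y xi) = fun x => monomial s xi * expf y xi x.
Proof.
elim: s => [|i s ih] /=; first by apply/funext => x; rewrite /monomial big_nil mul1r.
rewrite ih partial_cmul_expf; apply/funext => x.
by rewrite /monomial big_cons [xi 0 i * _]mulrC.
Qed.

Lemma expf_self y xi : expf y xi y = 1.
Proof. by rewrite /expf big1 ?expR0// => i _; rewrite subrr mulr0. Qed.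

Lemma expf_mul y xi eta : expf y xi \* expf y eta = expf y (xi + eta).
Proof.
apply/funext => x; rewrite /expf /= -expRD -big_split /=; congr expR.
by apply: eq_bigr => i _; rewrite mxE mulrDl.
Qed.

(** The symbol vanishes as a polynomial in [xi] and [eta]; derivatives of smooth functions depend on
    the index lists only up to permutation, just as monomials do. *)
Lemma diff2_exp_eq0 F : diff2 F ->
  (forall y xi eta, F (expf y xi) (expf y eta) y = 0) ->
  forall a b, smooth a -> smooth b -> F a b = fun _ => 0.
Proof.
move=> [N [c [s [t [sc FE]]]]] F0 a b sa sb; apply/funext => y; rewrite FE//.
apply: (@sum_monomial_eq0 _ _ (fun k => c k y) s t (fun s => dpow s a y)
  (fun s => dpow s b y)).
- by move=> u v uv; rewrite (dpow_perm sa uv).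
- by move=> u v uv; rewrite (dpow_perm sb uv).
move=> xi eta; rewrite -[RHS](F0 y xi eta) FE; try exact: smooth_expf.
by apply: eq_bigr => k _; rewrite !dpow_expf !expf_self !mulr1.
Qed.

(* The doubling map of the abelian group extension defined by [r]. *)
Lemma symmetric_cocycle_double (V : zmodType) (r : V -> V -> R) :
  (forall u v, r u v = r v u) ->
  (forall u v w, r v w - r (u + v) w + r u (v + w) - r u v = 0) ->
  forall u v, r (u + u) (v + v) = 2 * r u v + r (u + v) (u + v) - r u u - r v v.
Proof.
move=> rC rZ u v.
have E1 := rZ u u (v + v).
have E2 := rZ u v v.
have := rZ u v (u + v).
rewrite [r v (u + v)]rC [v + (u + v)]addrCA => E3.
by lra.
Qed.

Definition diffop N (c : 'I_N -> fn R) (s : 'I_N -> seq 'I_3) a : fn R :=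
  fun x => \sum_k c k x * dpow (s k) a x.

(** The Hochschild differential of a 1-cochain, in the sign convention of [hoch2]. *)
Definition hoch1 (G : fn R -> fn R) a b : fn R :=
  fun x => a x * G b x - G (a \* b) x + G a x * b x.

Lemma diff2_hoch1 N (c : 'I_N -> fn R) (s : 'I_N -> seq 'I_3) :
  (forall k, smooth (c k)) -> diff2 (hoch1 (diffop c s)).
Proof.
move=> sc.
have dm (u v : 'I_N -> seq 'I_3) :
    diff2 (fun a b x => \sum_k c k x * dpow (u k) a x * dpow (v k) b x).
  by apply: diff2_sum => k; exact: diff2_monomial.
have dM : diff2 (fun a b x => \sum_k c k x * dpow (s k) (a \* b) x).
  apply: diff2_sum => k.
  apply: (@diff2_scal _ (c k) (fun a b => dpow (s k) (a \* b))) => //.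
  exact/diff2_dpow/diff2_mul.
apply: eq_diff2 (diff2_add (diff2_add (dm (fun _ => [::]) s)
   (diff2_scal (smooth_cst (-1)) dM)) (dm s (fun _ => [::]))) => a b sa sb.
apply/funext => x; rewrite /hoch1 /scal /diffop mulN1r mulr_sumr mulr_suml /=.
by congr (_ - _ + _); apply: eq_bigr => k _; rewrite [c k x * a x]mulrC mulrA.
Qed.

(* Symbols turn [S] into a symmetric polynomial group cocycle [r] on [R^3];
   on its homogeneous part of degree [n] the doubling identity reads
   [(2 ^ n - 2) r = hoch1 (- h)] with [h xi = r xi xi]. In degree 1, where
   [2 ^ n - 2] vanishes, [r] is zero. *)
Lemma symmetric_cocycle2_coboundary S : diff2 S -> cocycle2 S ->
  (forall a b, smooth a -> smooth b -> S a b = S b a) ->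
  exists N (c : 'I_N -> fn R) (s : 'I_N -> seq 'I_3),
    (forall k, smooth (c k)) /\
    forall a b, smooth a -> smooth b -> S a b = hoch1 (diffop c s) a b.
Proof.
move=> dS Scoc Ssym; have [N [c [s [t [sc SE]]]]] := dS.
pose n k := (size (s k) + size (t k))%N.
pose w m : R := if m == 1%N then 0 else (2 - 2 ^+ m)^-1.
pose d k x := c k x * w (n k).
have sd k : smooth (d k) by apply: smooth_mul => //; exact: smooth_cst.
(* Concatenating the index lists restricts the symbol to the diagonal, giving [r xi xi] weighted by
   degree. *)
exists N, d, (fun k => s k ++ t k); split => // a b sa sb.
have dE : diff2 (fun a b x => S a b x + scal (fun _ => -1)
    (hoch1 (diffop d (fun k => s k ++ t k))) a b x).
  by apply: diff2_add => //; apply: diff2_scal; [exact: smooth_cst|exact: diff2_hoch1].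
suff E0 : forall y xi eta, S (expf y xi) (expf y eta) y +
    scal (fun _ => -1) (hoch1 (diffop d (fun k => s k ++ t k)))
      (expf y xi) (expf y eta) y = 0.
  apply/funext => x.
  have /(congr1 (fun u => u x)) := diff2_exp_eq0 dE E0 sa sb.
  by rewrite /scal mulN1r => /eqP; rewrite subr_eq0 => /eqP.
move=> y xi eta; rewrite /scal mulN1r /hoch1 expf_mul !expf_self mul1r mulr1.
have GE z : diffop d (fun k => s k ++ t k) (expf y z) y =
    \sum_k c k y * w (n k) * (monomial (s k) z * monomial (t k) z).
  by apply: eq_bigr => k _; rewrite dpow_expf expf_self mulr1 monomial_cat.
pose r u v := S (expf y u) (expf y v) y.
have rE u v : r u v = \sum_k c k y * monomial (s k) u * monomial (t k) v.
  rewrite /r SE; try exact: smooth_expf.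
  by apply: eq_bigr => k _; rewrite !dpow_expf !expf_self !mulr1.
have rC u v : r u v = r v u by rewrite /r Ssym//; exact: smooth_expf.
have rZ (u v z : pt R) : r v z - r (u + v) z + r u (v + z) - r u v = 0.
  have := Scoc _ _ _ (smooth_expf y u) (smooth_expf y v) (smooth_expf y z).
  move=> /(congr1 (fun u => u y)).
  by rewrite /hoch2 !expf_mul !expf_self mul1r mulr1.
have r0 u : r u 0 = r 0 0.
  by have := rZ u 0 0; rewrite !addr0; lra.
pose m k (u v : pt R) : R := monomial (s k) u * monomial (t k) v.
have rm (l : R) (u v : pt R) : r (l *: u) (l *: v) = \sum_k c k y * l ^+ n k * m k u v.
  rewrite rE; apply: eq_bigr => k _; rewrite !monomial_scale exprD /m; ring.
pose C1 k := c k y * (m k xi 0 + m k 0 eta - 2 * m k 0 0).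
(* The cocycle identity makes [r u 0] constant, hence by symmetry also [r 0 u]; the part of degree 1
   in [l] is extracted. *)
have part1 : \sum_k C1 k * (n k == 1%N)%:R = 0.
  apply: (sum_coef_eq0 (n := n)) => [l|k k' ->//].
  have := r0 (l *: xi); have := r0 (l *: eta); rewrite [r _ 0]rC => E2 E1.
  transitivity (r (l *: xi) (l *: 0) + r (l *: 0) (l *: eta) - 2 * r (l *: 0) (l *: 0)).
    rewrite !rm mulr_sumr -big_split /= -sumrB.
    by apply: eq_bigr => k _; rewrite /C1; ring.
  by rewrite !scaler0 E1 E2; ring.
pose C2 k := c k y * (2 ^+ n k * m k xi eta - 2 * m k xi eta -
  m k (xi + eta) (xi + eta) + m k xi xi + m k eta eta).
(* The doubling identity at [l *: xi], [l *: eta] is polynomial in [l]; its homogeneous parts are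
   reweighted by [w]. *)
have part2 : \sum_k C2 k * w (n k) = 0.
  apply: (sum_coef_eq0 (n := n)) => [l|k k' ->//].
  have dbl (u : pt R) : l *: u + l *: u = (2 * l) *: u.
    by rewrite -scalerDl mulr_natl mulr2n.
  have := symmetric_cocycle_double rC rZ (l *: xi) (l *: eta).
  rewrite (dbl xi) (dbl eta) -scalerDr 5!rm => E.
  transitivity (\sum_k c k y * (2 * l) ^+ n k * m k xi eta -
    (2 * (\sum_k c k y * l ^+ n k * m k xi eta) +
     \sum_k c k y * l ^+ n k * m k (xi + eta) (xi + eta) -
     \sum_k c k y * l ^+ n k * m k xi xi -
     \sum_k c k y * l ^+ n k * m k eta eta)); last by rewrite E subrr.
  rewrite mulr_sumr -big_split /= -!sumrB.
  by apply: eq_bigr => k _; rewrite /C2 exprMn; ring.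
rewrite -/(r xi eta) rE !GE.
(* The match is termwise: in degree 1 the weight is zero and [C1] is the whole term; in other
   degrees [(2 ^+ n - 2) * w n = -1]. *)
transitivity (\sum_k C1 k * (n k == 1%N)%:R - \sum_k C2 k * w (n k)); last first.
  by rewrite part1 part2 subrr.
rewrite -!sumrB -!big_split /= -!sumrB; apply: eq_bigr => k _.
rewrite -!/(m k _ _) -!mulrA -/(m k _ _) /C1 /C2 /w.
have [n1|n1] := eqVneq (n k) 1%N.
  have -> : m k xi 0 + m k 0 eta - 2 * m k 0 0 = m k xi eta.
    move: n1; rewrite /n /m /monomial.
    case: (s k) (t k) => [|i [|//]] [|j [|//]]//= _.
    - by rewrite !big_seq1 !big_nil !mxE; ring.
    - by rewrite !big_seq1 !big_nil !mxE; ring.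
  by rewrite mulr1n; ring.
have n2 : (2 - 2 ^+ n k : R) != 0.
  rewrite subr_eq0; case: (n k) n1 => [|[|p]]// _.
    by rewrite expr0; lra.
  have : (1 : R) <= 2 ^+ p by rewrite exprn_ege1// ler1n.
  by rewrite !exprS => p1; apply/eqP; lra.
by rewrite mulr0n; field.
Qed.

End Symbols.

(** * Primary obstructions *)

Section Obstruction.
Context {R : realType}.
Implicit Types (f g a b c phi : fn R) (x y z h : pt R) (i j : 'I_3) (s t : seq 'I_3).
Implicit Types F G S : fn R -> fn R -> fn R.
Implicit Types A B D : fn R -> fn R.

Lemma dpow_linear s (l : R) a b : smooth a -> smooth b ->
  dpow s (fun x => l * a x + b x) = fun x => l * dpow s a x + dpow s b x.
Proof.
move=> sa sb; elim: s => //= i s ->.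
have sA := smooth_dpow s sa; have sB := smooth_dpow s sb.
have sC : smooth (fun _ : pt R => l) by exact: smooth_cst.
rewrite partialD//; last exact: smooth_mul.
rewrite (@partialM _ i (fun _ => l))// partial_cst.
by apply/funext => x; rewrite mul0r addr0.
Qed.

Lemma diff2_linearl F (l : R) a b c : diff2 F ->
  smooth a -> smooth b -> smooth c ->
  F (fun x => l * a x + b x) c = fun x => l * F a c x + F b c x.
Proof.
move=> [N [d [s [t [sd FE]]]]] sa sb sc; rewrite !FE//; last first.
  by apply: smooth_add => //; apply: smooth_mul => //; exact: smooth_cst.
apply/funext => x; rewrite mulr_sumr -big_split /=; apply: eq_bigr => k _.
by rewrite dpow_linear//; ring.
Qed.

Lemma diff2_addr F a b c : diff2 F -> smooth a -> smooth b -> smooth c ->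
  F a (fun x => b x + c x) = fun x => F a b x + F a c x.
Proof.
move=> dF sa sb sc; have := diff2_linearl 1 (diff2_swap dF) sb sc sa.
rewrite (_ : (fun x => 1 * b x + c x) = fun x => b x + c x); last first.
  by apply/funext => x; rewrite mul1r.
by move=> ->; apply/funext => x; rewrite mul1r.
Qed.

(** The Leibniz rule is the cocycle identity at [(a,b,c)] minus the one at [(a,c,b)] plus the one at
    [(c,a,b)]; the other terms cancel because the product of functions is commutative. *)
Lemma cocycle2_skew_biderivation F : diff2 F -> cocycle2 F ->
  skew_biderivation (fun a b x => F a b x - F b a x).
Proof.
move=> dF Fcoc; split.
- by move=> a b sa sb; apply: smooth_sub; exact: diff2_smooth.
- by move=> a b _ _; apply/funext => x; rewrite opprB.
- move=> l a b c sa sb sc; apply/funext => x.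
  rewrite (diff2_linearl l dF sa sb sc).
  by rewrite (diff2_linearl l (diff2_swap dF) sa sb sc); ring.
- move=> a b c sa sb sc; apply/funext => x.
  have mC u v : u \* v = v \* u :> fn R by apply/funext => z /=; rewrite mulrC.
  have := congr1 (fun u => u x) (Fcoc _ _ _ sa sb sc).
  have := congr1 (fun u => u x) (Fcoc _ _ _ sa sc sb).
  have := congr1 (fun u => u x) (Fcoc _ _ _ sc sa sb).
  rewrite /hoch2 (mC c a) (mC c b) => E1 E2 E3.
  by lra.
Qed.

(** * Operators of one argument and cup products *)

Definition diff1 A : Prop := exists N (c : 'I_N -> fn R) (s : 'I_N -> seq 'I_3),
  (forall k, smooth (c k)) /\ forall a, smooth a -> A a = diffop c s a.

Lemma diff1_partial i : diff1 (partial i).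
Proof.
exists 1%N, (fun _ _ => 1), (fun _ => [:: i]); split.
  by move=> _; exact: smooth_cst.
by move=> a _; apply/funext => x; rewrite /diffop big_ord1 mul1r.
Qed.

Lemma diff1_comp_partial A i : diff1 A -> diff1 (A \o partial i).
Proof.
move=> [N [c [s [sc AE]]]]; exists N, c, (fun k => s k ++ [:: i]); split=> // a sa.
rewrite /= AE; last exact: smooth_partial.
by apply/funext => x; apply: eq_bigr => k _; rewrite dpow_cat.
Qed.

Lemma diff2_diff1 F phi : diff2 F -> smooth phi -> diff1 (F^~ phi).
Proof.
move=> [N [c [s [t [sc FE]]]]] sp.
exists N, (fun k x => c k x * dpow (t k) phi x), s; split.
  by move=> k; apply: smooth_mul => //; exact: smooth_dpow.
by move=> a sa; rewrite FE//; apply/funext => x; apply: eq_bigr => k _; rewrite mulrAC.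
Qed.

Lemma diff2_cup A B : diff1 A -> diff1 B -> diff2 (fun a b x => A a x * B b x).
Proof.
move=> [N [c [s [sc AE]]]] [M [d [t [sd BE]]]].
apply: (@eq_diff2 _ (fun a b x => \sum_(k < N) \sum_(l < M)
  (c k x * d l x) * dpow (s k) a x * dpow (t l) b x)); last first.
  by do 2 apply: diff2_sum => ?; apply: diff2_monomial; exact: smooth_mul.
move=> a b sa sb; apply/funext => x; rewrite AE// BE// /diffop mulr_suml.
apply: eq_bigr => k _; rewrite mulr_sumr; apply: eq_bigr => l _; ring.
Qed.

Definition derivation D : Prop := forall a b, smooth a -> smooth b ->
  D (a \* b) = fun x => a x * D b x + D a x * b x.

(** The graded Leibniz rule for the cup product, with [D] closed because it is a derivation. *)
Lemma hoch2_cup_derivation D A a b c x : derivation D ->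
  smooth a -> smooth b -> smooth c ->
  hoch2 (fun a b x => D a x * A b x) a b c x = - (D a x * hoch1 A b c x).
Proof. by move=> dD sa sb sc; rewrite /hoch2 /hoch1 dD//; ring. Qed.

(** [D] composed with [partial i] fails to be a derivation by the cross terms
    [D a * partial i b + partial i a * D b], while [partial j] is closed; only the cross terms
    remain. *)
Lemma hoch2_bivectorl (q : 'I_3 -> 'I_3 -> fn R) D a b c x : derivation D ->
  (forall a b, smooth a -> smooth b ->
     D (fun x => a x + b x) = fun x => D a x + D b x) ->
  smooth a -> smooth b -> smooth c ->
  hoch2 (fun a b x => \sum_i \sum_j
    q i j x * (D (partial i a) x * partial j b x)) a b c x =
  - (D a x * bivector q b c x + D b x * bivector q a c x).
Proof.
move=> dD aD sa sb sc; rewrite /hoch2 /bivector.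
rewrite [X in X - _ + _ - _]mulr_sumr [X in _ - X]mulr_suml -sumrB -big_split -sumrB /=.
rewrite !mulr_sumr -big_split -sumrN /=; apply: eq_bigr => i _.
rewrite [X in X - _ + _ - _]mulr_sumr [X in _ - X]mulr_suml -sumrB -big_split -sumrB /=.
rewrite !mulr_sumr -big_split -sumrN /=; apply: eq_bigr => j _.
have spa := smooth_partial i sa; have spb := smooth_partial i sb.
rewrite !partialM// aD; [|exact: smooth_mul|exact: smooth_mul].
by rewrite (dD a (partial i b))// (dD (partial i a) b)//; ring.
Qed.

(** The cross terms now arise in the second slot, which the differential reaches with the opposite
    sign. *)
Lemma hoch2_bivectorr (q : 'I_3 -> 'I_3 -> fn R) D a b c x : derivation D ->
  (forall a b, smooth a -> smooth b ->
     D (fun x => a x + b x) = fun x => D a x + D b x) ->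
  smooth a -> smooth b -> smooth c ->
  hoch2 (fun a b x => \sum_i \sum_j
    q i j x * (partial i a x * D (partial j b) x)) a b c x =
  D b x * bivector q a c x + D c x * bivector q a b x.
Proof.
move=> dD aD sa sb sc; rewrite /hoch2 /bivector.
rewrite [X in X - _ + _ - _]mulr_sumr [X in _ - X]mulr_suml -sumrB -big_split -sumrB /=.
rewrite !mulr_sumr -big_split /=; apply: eq_bigr => i _.
rewrite [X in X - _ + _ - _]mulr_sumr [X in _ - X]mulr_suml -sumrB -big_split -sumrB /=.
rewrite !mulr_sumr -big_split /=; apply: eq_bigr => j _.
have spb := smooth_partial j sb; have spc := smooth_partial j sc.
rewrite !partialM// aD; [|exact: smooth_mul|exact: smooth_mul].
by rewrite (dD b (partial j c))// (dD (partial j b) c)//; ring.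
Qed.

(** * The obstruction of the rescaled cocycle and its primitive *)

(** The cocycle identities at [(phi, F(a,b), c)] and [(a, F(b,c), phi)] pull [phi] out of the inner
    slots. The Leibniz rule of the skew part turns [F(a F(b,c), phi)] into [F(phi, a F(b,c))] plus
    the terms in [D]. *)
Lemma circ_scalE F phi a b c x : diff2 F -> cocycle2 F -> smooth phi ->
  smooth a -> smooth b -> smooth c ->
  circ (scal phi F) (scal phi F) a b c x =
  phi x * phi x * circ F F a b c x +
  phi x * (hoch2 (fun a b => F phi (F a b)) a b c x -
           (F a phi x - F phi a x) * F b c x).
Proof.
move=> dF Fcoc sp sa sb sc.
have mC u v : u \* v = v \* u :> fn R by apply/funext => z /=; rewrite mulrC.
have sF u v : smooth u -> smooth v -> smooth (F u v) by exact: diff2_smooth.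
have sM (u v : fn R) : smooth u -> smooth v -> smooth (u \* v) by exact: smooth_mul.
have [_ _ _ /(_ _ _ _ sa (sF _ _ sb sc) sp)] := cocycle2_skew_biderivation dF Fcoc.
move=> /(congr1 (fun u => u x)) E3.
have E1 := congr1 (fun u => u x) (Fcoc _ _ _ sp (sF _ _ sa sb) sc).
have E2 := congr1 (fun u => u x) (Fcoc _ _ _ sa (sF _ _ sb sc) sp).
(* The additive operator [F phi] is applied to the cocycle identity of [F] at [(a,b,c)], arranged
   without subtractions. *)
have E4 : F phi (a \* F b c) x + F phi (F a (b \* c)) x =
    F phi (F (a \* b) c) x + F phi (F a b \* c) x.
  have A1 := diff2_addr dF sp (sM _ _ sa (sF _ _ sb sc)) (sF _ _ sa (sM _ _ sb sc)).
  have A2 := diff2_addr dF sp (sF _ _ (sM _ _ sa sb) sc) (sM _ _ (sF _ _ sa sb) sc).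
  move: (congr1 (fun u => u x) A1) (congr1 (fun u => u x) A2) => /= <- <-.
  congr (F phi _ x); apply/funext => z /=.
  have := congr1 (fun u => u z) (Fcoc _ _ _ sa sb sc); rewrite /hoch2 /=.
  lra.
move: E1 E2 E3; rewrite /hoch2 /= (mC (F b c) phi) => E1 E2 E3.
rewrite /circ /scal.
rewrite -[fun x => phi x * F a b x]/(phi \* F a b).
rewrite -[fun x => phi x * F b c x]/(phi \* F b c).
have -> : F (phi \* F a b) c x =
    phi x * F (F a b) c x + F phi (F a b \* c) x - F phi (F a b) x * c x by lra.
have -> : F a (phi \* F b c) x = F a (F b c) x * phi x + F (a \* F b c) phi x
   - a x * F (F b c) phi x by lra.
have -> : F (a \* F b c) phi x = F phi (a \* F b c) x +
   (a x * (F (F b c) phi x - F phi (F b c) x) +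
    (F a phi x - F phi a x) * F b c x) by lra.
have -> : F phi (a \* F b c) x = F phi (F (a \* b) c) x + F phi (F a b \* c) x
   - F phi (F a (b \* c)) x by lra.
ring.
Qed.

Lemma coboundary3_circ_scal F phi : diff2 F -> cocycle2 F ->
  coboundary3 (circ F F) -> smooth phi ->
  coboundary3 (circ (scal phi F) (scal phi F)).
Proof.
move=> dF Fcoc [H0 [dH0 H0E]] sp.
have mC u v : u \* v = v \* u :> fn R by apply/funext => z /=; rewrite mulrC.
pose Q a b : fn R := fun x => F a b x - F b a x.
pose S a b : fn R := fun x => F a b x + F b a x.
have bQ : skew_biderivation Q := cocycle2_skew_biderivation dF Fcoc.
have dQ : diff2 Q.
  apply: eq_diff2 (diff2_add dF (diff2_scal (smooth_cst (-1)) (diff2_swap dF))).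
  by move=> a b _ _; apply/funext => x; rewrite /scal mulN1r.
have dS : diff2 S by exact: diff2_add dF (diff2_swap dF).
(* By commutativity, the differential of the opposite cochain at [(a,b,c)] is minus that of [F] at
   [(c,b,a)]. *)
have Scoc : cocycle2 S.
  move=> a b c sa sb sc; apply/funext => x.
  have := congr1 (fun u => u x) (Fcoc _ _ _ sa sb sc).
  have := congr1 (fun u => u x) (Fcoc _ _ _ sc sb sa).
  rewrite /hoch2 /S /= (mC c b) (mC b a); lra.
have [|N [g [s [sg SE]]]] := symmetric_cocycle2_coboundary dS Scoc.
  by move=> a b _ _; apply/funext => x; rewrite /S addrC.
pose G := diffop g s.
have dG : diff1 G by exists N, g, s.
pose D := Q^~ phi.
have dD : diff1 D by exact: diff2_diff1.
have derD : derivation D by case: bQ => _ _ _ QM a b sa sb; exact: QM.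
have addD a b : smooth a -> smooth b ->
    D (fun x => a x + b x) = fun x => D a x + D b x.
  by move=> sa sb; exact: (diff2_addr (diff2_swap dQ)).
pose q (i j : 'I_3) : fn R := Q (coord_fn i) (coord_fn j).
have sq i j : smooth (q i j) by apply: diff2_smooth => //; exact: smooth_coord.
pose K1 (a b : fn R) : fn R := fun x =>
  \sum_i \sum_j q i j x * (D (partial i a) x * partial j b x).
pose K2 (a b : fn R) : fn R := fun x =>
  \sum_i \sum_j q i j x * (partial i a x * D (partial j b) x).
pose LF (a b : fn R) := F phi (F a b).
pose DG (a b : fn R) : fn R := fun x => D a x * G b x.
have dK1 : diff2 K1.
  do 2 apply: diff2_sum => ?; apply: diff2_scal => //.
  by apply: diff2_cup; [exact: diff1_comp_partial|exact: diff1_partial].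
have dK2 : diff2 K2.
  do 2 apply: diff2_sum => ?; apply: diff2_scal => //.
  by apply: diff2_cup; [exact: diff1_partial|exact: diff1_comp_partial].
have dLF : diff2 LF by exact: diff2_post.
have dDG : diff2 DG by exact: diff2_cup.
(* The last three terms form a primitive of [- phi (D \cup F)]. As [F] is half of [S + Q], [DG]
   enters with 1/2. Modulo the Pluecker relation, [K1 / 3 + K2 / 6] has differential
   [- D(a) Q(b,c) / 2]. *)
pose H a b : fn R := fun x => scal (fun x => phi x * phi x) H0 a b x +
  (scal phi LF a b x + (scal (fun x => phi x * 2^-1) DG a b x +
  (scal (fun x => phi x * 3^-1) K1 a b x + scal (fun x => phi x * 6^-1) K2 a b x))).
exists H; split.
  have sl (l : R) : smooth (fun x => phi x * l).
    by apply: smooth_mul => //; exact: smooth_cst.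
  do ?[apply: diff2_add]; apply: diff2_scal => //; exact: smooth_mul.
move=> a b c sa sb sc; apply/funext => x.
rewrite circ_scalE//.
have -> : hoch2 H a b c x = phi x * phi x * hoch2 H0 a b c x +
   (phi x * hoch2 LF a b c x + (phi x * 2^-1 * hoch2 DG a b c x +
   (phi x * 3^-1 * hoch2 K1 a b c x + phi x * 6^-1 * hoch2 K2 a b c x))).
  by rewrite /hoch2 /H /scal; ring.
rewrite -H0E// hoch2_cup_derivation// hoch2_bivectorl// hoch2_bivectorr//.
have P := biderivation_pluecker x bQ sa sb sc sp.
rewrite -/(Q a phi x) -/(D a x) -SE// -!(skew_biderivationE bQ)//.
move: P; rewrite -/(D a x) -/(D b x) -/(D c x) => P.
have Eca : Q c a x = - Q a c x by rewrite /Q opprB.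
have -> : F b c x = 2^-1 * S b c x + 2^-1 * Q b c x by rewrite /S /Q; lra.
rewrite Eca in P.
(* Adding [phi / 6] times the Pluecker sum turns the coefficient -1/2 of [D(a) Q(b,c)] into -1/3 and
   supplies the other two products. *)
rewrite -[LHS]addr0 -[in LHS](mulr0 (phi x * 6^-1)) -P.
by field.
Qed.

End Obstruction.

Theorem theorem6 (R : realType) :
  (forall F1 : fn R -> fn R -> fn R,
     diff2 F1 -> cocycle2 F1 -> coboundary3 (circ F1 F1) ->
     forall phi : fn R, smooth phi ->
       coboundary3 (circ (scal phi F1) (scal phi F1)))
  /\
  (forall F1 : fn R -> fn R -> fn R,
     skew_biderivation F1 -> poisson F1 ->
     forall phi : fn R, smooth phi -> poisson (scal phi F1)).
Proof.
split=> [F1 dF1 F1coc F1obs phi sphi|F1 _ pF1 phi sphi].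
  exact: coboundary3_circ_scal.
exact: poisson_scal.
Qed.
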